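(* Let $\mathfrak{H}$ be a fat indecomposable $(-3)$-saturated Hoffman graph such that $\Lambda^{\mathrm{red}}(\mathfrak{H},3)$ is isomorphic to a sublattice of the standard lattice $\mathbb{Z}^n$. Then $\mathcal{S}^-(\mathfrak{H})$ is a connected graph which is isomorphic to $\mathsf{A}_m$, $\mathsf{D}_m$, $\tilde{\mathsf{A}}_m$ or $\tilde{\mathsf{D}}_m$ for some positive integer $m$.
   Context: Graphs are finite, non-empty, undirected, without loops or multiple edges. A Hoffman graph $\mathfrak{H}=(H,\mu)$ is a graph $H=(V,E)$ with a labeling $\mu:V\to\{f,s\}$ such that every vertex with label $f$ (a fat vertex) is adjacent to at least one vertex with label $s$ (a slim vertex), and fat vertices are pairwise non-adjacent. $V_s(\mathfrak{H})$, $V_f(\mathfrak{H})$ denote the sets of slim and fat vertices. $\mathfrak{H}$ is fat if every slim vertex has a fat neighbor. $N^f(x)$ is the set of fat neighbors of $x$, and $N^f(x,y)$ the set of common fat neighbors of $x$ and $y$. If the adjacency matrix is $\begin{pmatrix}A_s&C\\C^T&O\end{pmatrix}$ with fat vertices last, the eigenvalues of $\mathfrak{H}$ are those of $B(\mathfrak{H})=A_s-CC^T$; $\lambda_{\min}(\mathfrak{H})$ is the smallest one. A reduced representation of norm $m$ of $\mathfrak{H}$ is a map $\psi:V_s(\mathfrak{H})\to\mathbb{R}^N$ (for some $N$) with $(\psi(x),\psi(y))$ equal to $m-|N^f(x)|$ if $x=y$, to $1-|N^f(x,y)|$ if $x\ne y$ are adjacent, and to $-|N^f(x,y)|$ otherwise.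 It exists if and only if $\lambda_{\min}(\mathfrak{H})\ge -m$. $\Lambda^{\mathrm{red}}(\mathfrak{H},m)$ is the lattice generated by $\{\psi(x)\mid x\in V_s(\mathfrak{H})\}$; up to isometry it does not depend on $\psi$. Isomorphism of lattices means isometry. $\mathcal{S}^-(\mathfrak{H})$ is the graph with vertex set $V_s(\mathfrak{H})$ in which distinct $x,y$ are adjacent if and only if $(\psi(x),\psi(y))<0$ (independent of $m$ and $\psi$). $\mathfrak{H}$ is the sum $\mathfrak{H}^1\uplus\mathfrak{H}^2$ of two non-empty induced Hoffman subgraphs if: $V(\mathfrak{H})=V(\mathfrak{H}^1)\cup V(\mathfrak{H}^2)$; $\{V_s(\mathfrak{H}^1),V_s(\mathfrak{H}^2)\}$ is a partition of $V_s(\mathfrak{H})$; if $x\in V_s(\mathfrak{H}^i)$, $y\in V_f(\mathfrak{H})$ are adjacent then $y\in V_f(\mathfrak{H}^i)$; and any $x\in V_s(\mathfrak{H}^1)$, $y\in V_s(\mathfrak{H}^2)$ have at most one common fat neighbor, and they have one if and only if they are adjacent. $\mathfrak{H}$ is indecomposable if it is not such a sum. $\mathfrak{H}$ is $(-3)$-saturated if $\lambda_{\min}(\mathfrak{H})\ge-3$ and no new fat vertex can be attached to $\mathfrak{H}$ (joined to some non-empty set of slim vertices, everything else unchanged) so that the resulting Hoffman graph has smallest eigenvalue at least $-3$. Dynkin graphs: $\mathsf{A}_m$ is the path on $m$ vertices; $\mathsf{D}_m$ ($m\ge4$) is the tree on $m$ vertices obtained from a path on $m-1$ vertices by attaching one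 extra leaf to a vertex adjacent to an end; $\tilde{\mathsf{A}}_m$ ($m\ge2$) is the cycle on $m+1$ vertices; $\tilde{\mathsf{D}}_4$ is the star $K_{1,4}$; $\tilde{\mathsf{D}}_m$ ($m\ge5$) is the tree on $m+1$ vertices obtained from a path on $m-1$ vertices by attaching one extra leaf to each of the two vertices adjacent to the ends. *)

(* Defs.v *)
From mathcomp Require Import all_boot all_order all_algebra.
From mathcomp Require Import boolp classical_sets functions reals.

Set Implicit Arguments.
Unset Strict Implicit.
Unset Printing Implicit Defensive.

Import Order.TTheory GRing.Theory Num.Theory.
Local Open Scope ring_scope.

Record hoffman : Type := Hoffman {
  vert : finType;
  adj : rel vert;
  fat : pred vert; (* the slim vertices are those that are not fat *)
  vert_gt0 : (0 < #|vert|)%N;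
  adj_sym : symmetric adj;
  adj_irr : irreflexive adj;
  fat_has_slim : forall x, fat x -> exists y, ~~ fat y && adj x y;
  fat_indep : forall x y, fat x -> fat y -> ~~ adj x y
}.

Definition slim (H : hoffman) : pred (vert H) := fun x => ~~ fat x.

Definition slim_vert (H : hoffman) : finType := {x : vert H | slim x}.
Definition fat_vert (H : hoffman) : finType := {x : vert H | fat x}.

Definition fat_nbrs (H : hoffman) (x : vert H) : {set vert H} :=
  [set z | fat z && adj x z].
Definition common_fat_nbrs (H : hoffman) (x y : vert H) : {set vert H} :=
  fat_nbrs x :&: fat_nbrs y.

Definition is_fat_hoffman (H : hoffman) : Prop :=
  forall x : vert H, slim x -> exists z, fat z && adj x z.

Section Eigenvalues.
Variables (R : realType) (H : hoffman).

Definition adj_ss : 'M[R]_#|slim_vert H| :=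
  \matrix_(i, j) (adj (val (enum_val i)) (val (enum_val j)))%:R.
Definition adj_sf : 'M[R]_(#|slim_vert H|, #|fat_vert H|) :=
  \matrix_(i, j) (adj (val (enum_val i)) (val (enum_val j)))%:R.

Definition hoffman_mx : 'M[R]_#|slim_vert H| := adj_ss - adj_sf *m adj_sf^T.

(* The infimum is a minimum: this set is finite, and it is non-empty because
   there is a slim vertex and hoffman_mx is symmetric. *)
Definition lambda_min : R := inf [set a : R | eigenvalue hoffman_mx a]%classic.

End Eigenvalues.

Definition dotv (R : realType) (N : nat) (u v : 'rV[R]_N) : R :=
  \sum_(i < N) u 0 i * v 0 i.

Definition reduced_rep (R : realType) (H : hoffman) (m : R) (N : nat)
    (psi : slim_vert H -> 'rV[R]_N) : Prop :=
  forall x y : slim_vert H,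
    dotv (psi x) (psi y) =
      if x == y then m - #|fat_nbrs (val x)|%:R
      else if adj (val x) (val y)
           then 1 - #|common_fat_nbrs (val x) (val y)|%:R
           else - #|common_fat_nbrs (val x) (val y)|%:R.

Definition lattice_gen (R : realType) (T : finType) (N : nat)
    (psi : T -> 'rV[R]_N) : set 'rV[R]_N :=
  [set v | exists c : {ffun T -> int}, v = \sum_x psi x *~ c x]%classic.

Definition standard_lattice (R : realType) (n : nat) : set 'rV[R]_n :=
  [set v | forall i, exists k : int, v 0 i = k%:~R]%classic.
Arguments standard_lattice : clear implicits.

Definition sublattice (R : realType) (n : nat) (L M : set 'rV[R]_n) : Prop :=
  [/\ (L `<=` M)%classic, L 0 & forall u v, L u -> L v -> L (u - v)].

Definition lattice_isometric (R : realType) (N n : nat)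
    (L : set 'rV[R]_N) (M : set 'rV[R]_n) : Prop :=
  exists phi : 'rV[R]_N -> 'rV[R]_n,
    [/\ set_bij L M phi,
        forall u v, L u -> L v -> phi (u + v) = phi u + phi v
      & forall u v, L u -> L v -> dotv (phi u) (phi v) = dotv u v].

Definition special_adj (R : realType) (H : hoffman) (N : nat)
    (psi : slim_vert H -> 'rV[R]_N) : rel (slim_vert H) :=
  fun x y => (x != y) && (dotv (psi x) (psi y) < 0).

(* W is the vertex set of a non-empty induced Hoffman subgraph; the other
   axioms are inherited by any induced subgraph. *)
Definition hoffman_subset (H : hoffman) (W : {set vert H}) : Prop :=
  W != finset.set0 /\
  (forall x, x \in W -> fat x -> exists y, [&& y \in W, slim y & adj x y]).

Definition slim_part (H : hoffman) (W : {set vert H}) : {set vert H} :=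
  [set x in W | slim x].

Definition is_hoffman_sum (H : hoffman) (W1 W2 : {set vert H}) : Prop :=
  [/\ W1 :|: W2 = [set: vert H],
      [/\ slim_part W1 != finset.set0, slim_part W2 != finset.set0,
          slim_part W1 :&: slim_part W2 = finset.set0
        & slim_part W1 :|: slim_part W2 = [set x | slim x]],
      (forall x y, x \in slim_part W1 -> fat y -> adj x y -> y \in W1) /\
      (forall x y, x \in slim_part W2 -> fat y -> adj x y -> y \in W2)
    & forall x y, x \in slim_part W1 -> y \in slim_part W2 ->
        (#|common_fat_nbrs x y| <= 1)%N /\
        (#|common_fat_nbrs x y| = 1%N <-> adj x y)].

Definition indecomposable (H : hoffman) : Prop :=
  ~ exists W1 W2 : {set vert H},
      [/\ hoffman_subset W1, hoffman_subset W2 & is_hoffman_sum W1 W2].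

(* The new fat vertex is None; its neighbours are the slim vertices in S. *)
Section Attach.
Variables (H : hoffman) (S : {set slim_vert H}).

Definition attach_adj : rel (option (vert H)) := fun u v =>
  match u, v with
  | Some x, Some y => adj x y
  | Some x, None | None, Some x => x \in val @: S
  | None, None => false
  end.

Definition attach_fat : pred (option (vert H)) := fun u =>
  if u is Some x then fat x else true.

Lemma attach_gt0 : (0 < #|{: option (vert H)}|)%N.
Proof. by rewrite card_option. Qed.

Lemma attach_sym : symmetric attach_adj.
Proof. by case=> [x|] [y|] //=; rewrite adj_sym. Qed.

Lemma attach_irr : irreflexive attach_adj.
Proof. by case=> [x|] //=; rewrite adj_irr. Qed.

Lemma attach_has_slim : S != finset.set0 -> forall u, attach_fat u ->
  exists v, ~~ attach_fat v && attach_adj u v.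
Proof.
case/set0Pn=> s sS [x /fat_has_slim[y]|_]; first by exists (Some y).
by exists (Some (val s)); apply/andP; split; [exact: (valP s)|exact: imset_f].
Qed.

Lemma attach_indep u v : attach_fat u -> attach_fat v -> ~~ attach_adj u v.
Proof.
case: u v => [x|] [y|] //= fx fy; first exact: fat_indep.
- by apply/imsetP => -[[s ss] _ /= xs]; move: ss; rewrite -xs /slim fx.
- by apply/imsetP => -[[s ss] _ /= ys]; move: ss; rewrite -ys /slim fy.
Qed.

Definition attach (S0 : S != finset.set0) : hoffman :=
  Hoffman attach_gt0 attach_sym attach_irr (attach_has_slim S0) attach_indep.

End Attach.

Definition saturated (R : realType) (m : R) (H : hoffman) : Prop :=
  - m <= lambda_min R H /\
  forall (S : {set slim_vert H}) (S0 : S != finset.set0),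
    ~ - m <= lambda_min R (attach S0).

Definition sym_graph (n : nat) (arc : rel nat) : rel 'I_n :=
  fun i j => arc i j || arc j i.

Definition A_graph (m : nat) : rel 'I_m :=
  @sym_graph m (fun i j => j == i.+1).

(* path 0, ..., m-2, leaf m-1 attached to 1 *)
Definition D_graph (m : nat) : rel 'I_m :=
  @sym_graph m (fun i j => (j == i.+1) && (j <= m - 2)%N
                       || (i == 1%N) && (j == m - 1)%N).

Definition tA_graph (m : nat) : rel 'I_m.+1 :=
  @sym_graph m.+1 (fun i j => j == (i.+1 %% m.+1)%N).

(* path 0, ..., m-2, leaf m-1 attached to 1, leaf m attached to m-3; for m = 4
   both leaves are attached to 1 and the graph is the star K_{1,4} *)
Definition tD_graph (m : nat) : rel 'I_m.+1 :=
  @sym_graph m.+1 (fun i j => [|| (j == i.+1) && (j <= m - 2)%N,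
                                 (i == 1%N) && (j == m - 1)%N
                               | (i == m - 3)%N && (j == m)]).

Arguments A_graph : clear implicits.
Arguments D_graph : clear implicits.
Arguments tA_graph : clear implicits.
Arguments tD_graph : clear implicits.

Definition graph_iso (T U : finType) (e : rel T) (f : rel U) : Prop :=
  exists2 h : T -> U, bijective h & forall x y, f (h x) (h y) = e x y.

Definition connected_graph (T : finType) (e : rel T) : Prop :=
  (0 < #|T|)%N /\ forall x y, connect e x y.

(* Main.v *)
(* Transport the reduced representation to an integral one [a]. As the graph is
   fat, every [a x] has norm at most 2, hence is 0, a signed basis vector, or a
   sum of two of them. Saturation makes both signs occur at every coordinate
   that occurs: otherwise a fat vertex adjacent to the slim vertices that are
   non-zero there could be attached. Two vectors of opposite sign at a
   coordinate are joined in the special graph, possibly through a third one;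
   as the graph whose edges are the non-zero inner products is connected by
   indecomposability, so is the special graph.

   Tensoring [a x] with the indicator vector of the fat neighbours of [x] gives
   integral vectors of norm at most 2 with pairwise non-positive inner products,
   negative exactly on the edges of the special graph. At each coordinate of
   such a vector at most two neighbours attach, and if two of them do and there
   is a third neighbour, these two are leaves. A longest path is therefore a
   cycle exhausting the graph, or misses at most two leaves near its ends. *)
Require Import Defs.
From mathcomp Require Import all_boot all_order all_algebra.
From mathcomp Require Import zify ring.
From mathcomp Require Import boolp classical_sets functions reals.

Set Implicit Arguments.
Unset Strict Implicit.
Unset Printing Implicit Defensive.

Import Order.TTheory GRing.Theory Num.Theory.
Local Open Scope ring_scope.

(** * Integral vectors of norm at most 2 *)

Definition dotz (I : finType) (a b : I -> int) : int := \sum_i a i * b i.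

Lemma dotzC (I : finType) (a b : I -> int) : dotz a b = dotz b a.
Proof. by apply: eq_bigr => i _; rewrite mulrC. Qed.

Lemma dotz_ge0 (I : finType) (b : I -> int) : 0 <= dotz b b.
Proof. by apply: sumr_ge0 => i _; rewrite -expr2 sqr_ge0. Qed.

Lemma dotz_lt0 (I : finType) (a b : I -> int) :
  dotz a b < 0 -> exists i, a i * b i < 0.
Proof.
move=> ab; apply/existsP; apply: contraLR ab => /existsPn ab.
by rewrite -leNgt sumr_ge0 // => i _; rewrite leNgt ab.
Qed.

Lemma dotz_gt0 (I : finType) (a b : I -> int) :
  0 < dotz a b -> exists i, 0 < a i * b i.
Proof.
move=> ab; apply/existsP; apply: contraLR ab => /existsPn ab.
by rewrite -leNgt sumr_le0 // => i _; rewrite leNgt ab.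
Qed.

Lemma dotz_split (I : finType) (a b : I -> int) (i j : I) : i != j ->
  dotz a b = a i * b i + a j * b j + \sum_(k | (k != i) && (k != j)) a k * b k.
Proof.
by move=> ij; rewrite /dotz (bigD1 i) //= (bigD1 j) 1?eq_sym //= addrA.
Qed.

Lemma sqz_gt0 (m : int) : m != 0 -> 1 <= m * m.
Proof. nia. Qed.

Lemma mulz_lt0_gt0 (a b c : int) : a * b < 0 -> a * c < 0 -> 0 < b * c.
Proof. by move=> ab ac; have [a0|a0|a0] := ltgtP a 0; nia. Qed.

Lemma short_entry (I : finType) (a : I -> int) (i : I) :
  dotz a a <= 2 -> -1 <= a i <= 1.
Proof.
rewrite /dotz (bigD1 i) //=; set r := \sum_(k | _) _ => le2.
have : 0 <= r by apply: sumr_ge0 => k _; rewrite -expr2 sqr_ge0.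
nia.
Qed.

Lemma short_unit (I : finType) (a : I -> int) (i : I) :
  dotz a a <= 2 -> a i != 0 -> a i = 1 \/ a i = -1.
Proof. by move=> /(short_entry i); lia. Qed.

(** Two non-zero entries already use up a norm of 2, so every other entry vanishes. *)
Lemma short_support (I : finType) (a : I -> int) (i j : I) :
  dotz a a <= 2 -> i != j -> a i != 0 -> a j != 0 ->
  forall b, dotz a b = a i * b i + a j * b j.
Proof.
move=> le2 ij ai aj b; rewrite (dotz_split a b ij) big1 ?addr0 //.
move=> k kij; suff -> : a k = 0 by rewrite mul0r.
have sq_ge0 l : (l != i) && (l != j) -> 0 <= a l * a l.
  by rewrite -expr2 sqr_ge0.
move: le2; rewrite (dotz_split a a ij) => le2.
have /eqP: \sum_(k | (k != i) && (k != j)) a k * a k = 0.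
  apply/eqP; rewrite eq_le sumr_ge0 // andbT.
  have := sqz_gt0 ai; have := sqz_gt0 aj; lia.
rewrite psumr_eq0 // => /allP /(_ k (mem_index_enum _)).
by rewrite kij mulf_eq0 orbb => /eqP.
Qed.

Lemma short_third (I : finType) (a : I -> int) (i j k : I) :
  dotz a a <= 2 -> a i != 0 -> a j != 0 -> a k != 0 -> i != j -> i != k ->
  j = k.
Proof.
move=> le2 ai aj ak ij ik; apply/eqP; case: (eqVneq j k) => // jk.
(* Pairing [a] with the indicator of [k] gives [a k], but only [i] and [j] contribute to it. *)
have := short_support le2 ij ai aj (fun l => (l == k)%:R).
rewrite (negPf ik) (negPf jk) !mulr0 addr0 /dotz (bigD1 k) //= eqxx mulr1.
rewrite big1 => [|l /negPf ->]; last by rewrite mulr0.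
by rewrite addr0 => /eqP; rewrite (negPf ak).
Qed.

(* That is, [a = s e_i + t e_j] and [b = s e_i - t e_j] with signs [s], [t]. *)
Lemma short_twins (I : finType) (a b : I -> int) (i : I) :
  dotz a a <= 2 -> dotz b b <= 2 -> dotz a b <= 0 -> 0 < a i * b i ->
  exists j, [/\ j != i, a j != 0,
    a i = b i, a j = - b j & forall c, dotz a c = a i * c i + a j * c j].
Proof.
move=> a2 b2 ab abi.
have ai : a i != 0 by apply: contraTneq abi => ->; rewrite mul0r.
have [j /andP[ji abj]] : exists j, (j != i) && (a j * b j < 0).
  apply/existsP; apply: contraLR ab => /existsPn abn.
  rewrite -ltNge /dotz (bigD1 i) //= ltr_wpDr // sumr_ge0 // => k ki.
  by rewrite leNgt; have := abn k; rewrite ki.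
have aj : a j != 0 by apply: contraTneq abj => ->; rewrite mul0r.
have := (short_entry i a2, short_entry i b2,
         short_entry j a2, short_entry j b2).
move=> [[[]]] *; exists j; split=> //; first by nia.
- by nia.
- by apply: short_support; rewrite // eq_sym.
Qed.

Section ShortVectors.
Variables (T P : finType) (v : T -> P -> int) (e : rel T).
Hypothesis v_short : forall x, dotz (v x) (v x) <= 2.
Hypothesis v_le0 : forall x y, x != y -> dotz (v x) (v y) <= 0.
Hypothesis eE : forall x y, e x y = (x != y) && (dotz (v x) (v y) < 0).

(** Both [y2] and [y3] are twins of [y1] at [p]. As [y1] has only one other non-zero coordinate,
    both have the opposite sign to [y1] at that same one; so they agree with each other at two
    coordinates and their inner product is positive. *)
Lemma no_short_triplets (y1 y2 y3 : T) (p : P) : uniq [:: y1; y2; y3] ->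
  0 < v y1 p * v y2 p -> 0 < v y1 p * v y3 p -> False.
Proof.
rewrite /= !inE negb_or andbT -andbA => /and3P[n12 n13 n23] g12 g13.
have [q [qp y1q p12 q12 dot1]] :=
  short_twins (v_short y1) (v_short y2) (v_le0 n12) g12.
have [r [rp y1r p13 r13 _]] :=
  short_twins (v_short y1) (v_short y3) (v_le0 n13) g13.
have y1p : v y1 p != 0 by apply: contraTneq g12 => ->; rewrite mul0r.
have qr : q = r by apply: (short_third (v_short y1) y1p); rewrite // eq_sym.
subst r.
have := v_le0 n23; rewrite (short_support (v_short y2) qp); [|lia..].
have := sqz_gt0 y1p; have := sqz_gt0 y1q; nia.
Qed.

(** Suppose [z != x]. Then [y], [y'] are twins at [p], and so are [x], [z], with the opposite sign.
    The edge from [x] to [w] now gives [w] the sign of [y] and [y'] at [p], against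
    [no_short_triplets]. *)
Lemma twin_is_leaf (x y y' w z : T) (p : P) : e x y -> e x w ->
  uniq [:: y; y'; w] -> v x p * v y p < 0 -> v x p * v y' p < 0 ->
  e y z -> z = x.
Proof.
move=> /[!eE] /andP[xy xy0] /andP[xw xw0] yy'w xyp xy'p /andP[yz yz0].
apply/eqP; case: (eqVneq z x) => // zx.
have yy'p : 0 < v y p * v y' p by apply: mulz_lt0_gt0 xyp xy'p.
move: (yy'w); rewrite /= !inE negb_or andbT -andbA => /and3P[yy' yw y'w].
have [q [qp yq p1 q1 doty]] :=
  short_twins (v_short y) (v_short y') (v_le0 yy') yy'p.
have yp : v y p != 0 by apply: contraTneq xyp => ->; rewrite mulr0.
have doty' : forall c, dotz (v y') c = v y' p * c p + v y' q * c q.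
  by apply: short_support; rewrite ?[p == q]eq_sym // -?p1 // -oppr_eq0 -q1.
have := (short_unit (v_short y) yp, short_unit (v_short y) yq) => -[yp1 yq1].
have y'z : y' != z.
  apply: contraTneq yz0 => <-; rewrite doty -p1 -(opprK (v y' q)) -q1.
  by clear -yp1 yq1; case: yp1 => ->; case: yq1 => ->.
have := v_le0 y'z; move: yz0; rewrite doty doty' => yz0 y'z0.
have xp : v x p != 0 by apply: contraTneq xyp => ->; rewrite mul0r.
have xp1 := short_unit (v_short x) xp.
have y'q : v y' q = - v y q by rewrite q1 opprK.
(* In the sum of the inner products of [z] with [y] and [y'] the coordinate [q] cancels, so [z] has
   the sign opposite to [y] at [p]. *)
have xzp : 0 < v x p * v z p.
  move: xyp yz0 y'z0; rewrite -p1 y'q.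
  clear -xp1 yp1 yq1.
  by case: xp1 => ->; case: yp1 => ->; case: yq1 => ->; lia.
rewrite eq_sym in zx.
have [r [rp xr px rx dotx]] :=
  short_twins (v_short x) (v_short z) (v_le0 zx) xzp.
have xr1 := short_unit (v_short x) xr.
have zw : z != w.
  apply: contraTneq xw0 => <-; rewrite dotx -px -(opprK (v z r)) -rx.
  by clear -xp1 xr1; case: xp1 => ->; case: xr1 => ->.
have zr : v z r = - v x r by rewrite rx opprK.
have dotz' : forall c, dotz (v z) c = v z p * c p + v z r * c r.
  by apply: short_support; rewrite ?[p == r]eq_sym // -?px // -oppr_eq0 -rx.
have := v_le0 zw; move: xw0; rewrite dotx dotz' => xw0 zw0.
(* Likewise [r] cancels in the sum of the inner products of [w] with [x] and [z]. *)
case: (no_short_triplets (p := p) yy'w) => //.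
move: xyp xw0 zw0; rewrite -px zr.
clear -xp1 yp1 xr1.
by case: xp1 => ->; case: xr1 => ->; case: yp1 => ->; lia.
Qed.

(* Neighbours of [x] are coloured by a coordinate at which they have the
   opposite sign to [x]; there are at most two such coordinates. *)
Lemma root_coloring : exists c : rel T,
  (forall x y1 y2 y3, e x y1 -> e x y2 -> e x y3 -> uniq [:: y1; y2; y3] ->
     c x y1 = c x y2 -> c x y1 = c x y3 -> False) /\
  (forall x y y' w z, e x y -> e x y' -> e x w -> uniq [:: y; y'; w] ->
     c x y = c x y' -> e y z -> z = x).
Proof.
have /boolp.choice[p pP] (xy : T * T) : exists p : option P,
    e xy.1 xy.2 -> if p is Some p then v xy.1 p * v xy.2 p < 0 else false.
  have [|] := boolP (e _ _); last by exists None.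
  by rewrite eE => /andP[_ /dotz_lt0[p pP]]; exists (Some p).
(* The colour is Boolean: it tells whether the chosen coordinate is the one picked in the support of
   [x]. As that support has at most two elements, equal colours mean equal coordinates. *)
pose c x y := p (x, y) == [pick p | v x p != 0].
have cP x y y' : e x y -> e x y' -> c x y = c x y' -> p (x, y) = p (x, y').
  move=> /(pP (x, y)) /= + /(pP (x, y')) /=; rewrite /c.
  case: (p (x, y)) => // q qP; case: (p (x, y')) => // q' q'P.
  have xq : v x q != 0 by apply: contraTneq qP => ->; rewrite mul0r.
  have xq' : v x q' != 0 by apply: contraTneq q'P => ->; rewrite mul0r.
  case: pickP => [r xr|/(_ q)]; last by rewrite xq.
  have [[->]|qr] := eqVneq (Some q) (Some r); first by move/esym/eqP => [->].
  move/esym/negbT => q'r; congr Some.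
  by apply: (short_third (v_short x) xr xq xq'); rewrite eq_sym.
exists c; split=> [x y1 y2 y3 e1 e2 e3 u c12 c13|x y y' w z xy xy' xw u cyy'].
  move: (pP (x, y1) e1) (pP (x, y2) e2) (pP (x, y3) e3) => /=.
  rewrite -(cP x y1 y2) // -(cP x y1 y3) //; case: (p _) => // q g1 g2 g3.
  by apply: (no_short_triplets (p := q) u); apply: mulz_lt0_gt0 g1 _.
move: (pP (x, y) xy) (pP (x, y') xy') => /=.
rewrite -(cP x y y') //; case: (p _) => // q gy gy'.
exact: twin_is_leaf xy xw u gy gy'.
Qed.

End ShortVectors.

(** * Longest paths *)

Lemma graph_iso_seq (T : finType) (e : rel T) (m : nat) (arc : rel nat)
    (x0 : T) (s : seq T) :
  size s = m -> uniq s -> (forall x, x \in s) ->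
  (forall i j, (i < m)%N -> (j < m)%N ->
     e (nth x0 s i) (nth x0 s j) = arc i j || arc j i) ->
  graph_iso e (@sym_graph m arc).
Proof.
move=> <- us s_all arcE.
have idx x : (index x s < size s)%N by rewrite index_mem.
exists (fun x => Ordinal (idx x)) => [|x y]; last first.
  by rewrite /sym_graph /= -arcE ?nth_index.
exists (fun i : 'I_(size s) => nth x0 s i) => [x|i].
  by rewrite nth_index.
by apply: val_inj; rewrite /= index_uniq.
Qed.

Section LongestPath.
Local Open Scope nat_scope.
Variables (T : finType) (e c : rel T).
Hypotheses (esym : symmetric e) (eirr : irreflexive e).
Hypothesis econn : forall x y, connect e x y.
Hypothesis color_le2 : forall x y1 y2 y3,
  e x y1 -> e x y2 -> e x y3 -> uniq [:: y1; y2; y3] ->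
  c x y1 = c x y2 -> c x y1 = c x y3 -> False.
Hypothesis color_leaf : forall x y y' w z,
  e x y -> e x y' -> e x w -> uniq [:: y; y'; w] ->
  c x y = c x y' -> e y z -> z = x.

Definition longest (p : seq T) := [/\ sorted e p, uniq p &
  forall q, sorted e q -> uniq q -> (size q <= size p)].

Ltac distinct := rewrite /= ?inE ?negb_or;
  repeat (apply/andP; split); rewrite // eq_sym //.

Ltac arith := repeat match goal with
  | H : is_true (e _ _) |- _ => clear H
  | H : is_true (_ \in _) |- _ => clear H
  | H : is_true (_ \notin _) |- _ => clear H
  | H : longest _ |- _ => clear H
  | H : symmetric _ |- _ => clear H
  | H : irreflexive _ |- _ => clear H
  | H : forall _ : T, _ |- _ => clear H
  | H : forall _ _ : T, _ -> _ |- _ => clear H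
  end; lia.

(** Two of the three neighbours share a colour and are therefore leaves; any such pair contains [y1]
    or [y2]. *)
Lemma claw_leaf (x y1 y2 y3 z1 z2 : T) : e x y1 -> e x y2 -> e x y3 ->
  y1 != y2 -> y1 != y3 -> y2 != y3 -> e y1 z1 -> e y2 z2 ->
  z1 = x \/ z2 = x.
Proof.
move=> e1 e2 e3 n12 n13 n23 f1 f2.
have [c12|c12] := eqVneq (c x y1) (c x y2).
  by left; apply: color_leaf e1 e2 e3 _ c12 f1; distinct.
have [c13|c13] := eqVneq (c x y1) (c x y3).
  by left; apply: color_leaf e1 e3 e2 _ c13 f1; distinct.
have c23 : c x y2 = c x y3.
  by move: c12 c13; case: (c x y1); case: (c x y2); case: (c x y3).
by right; apply: color_leaf e2 e3 e1 _ c23 f2; distinct.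
Qed.

(** No colour occurs three times, so each of the four neighbours shares its colour with another
    one. *)
Lemma star_leaf (x y1 y2 y3 y4 z : T) :
  e x y1 -> e x y2 -> e x y3 -> e x y4 -> uniq [:: y1; y2; y3; y4] ->
  e y1 z -> z = x.
Proof.
move=> e1 e2 e3 e4; rewrite /= !inE !negb_or !andbT -!andbA.
case/and5P=> n12 n13 n14 n23 /andP[n24 n34] f1.
have [c12|c12] := eqVneq (c x y1) (c x y2).
  by apply: color_leaf e1 e2 e3 _ c12 f1; distinct.
have [c13|c13] := eqVneq (c x y1) (c x y3).
  by apply: color_leaf e1 e3 e2 _ c13 f1; distinct.
have [c14|c14] := eqVneq (c x y1) (c x y4).
  by apply: color_leaf e1 e4 e2 _ c14 f1; distinct.
case: (color_le2 e2 e3 e4); first by distinct.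
  by move: c12 c13; case: (c x y1); case: (c x y2); case: (c x y3).
by move: c12 c14; case: (c x y1); case: (c x y2); case: (c x y4).
Qed.

Lemma degree_le4 (x y1 y2 y3 y4 y5 : T) :
  e x y1 -> e x y2 -> e x y3 -> e x y4 -> e x y5 ->
  uniq [:: y1; y2; y3; y4; y5] -> False.
Proof.
move=> e1 e2 e3 e4 e5; rewrite /= !inE !negb_or !andbT -!andbA.
case/and5P=> n12 n13 n14 n15 /and5P[n23 n24 n25 n34 /andP[n35 n45]].
have D a b d : e x a -> e x b -> e x d -> a != b -> a != d -> b != d ->
    c x a = c x b -> c x a = c x d -> False.
  by move=> ea eb ed *; apply: (color_le2 ea eb ed) => //; distinct.
move: (D _ _ _ e1 e2 e3) (D _ _ _ e1 e2 e4) (D _ _ _ e1 e2 e5)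
  (D _ _ _ e1 e3 e4) (D _ _ _ e1 e3 e5) (D _ _ _ e1 e4 e5)
  (D _ _ _ e2 e3 e4) (D _ _ _ e2 e3 e5) (D _ _ _ e2 e4 e5)
  (D _ _ _ e3 e4 e5).
clear D color_le2 color_leaf.
by case: (c x y1); case: (c x y2); case: (c x y3); case: (c x y4);
  case: (c x y5); auto 10.
Qed.

Lemma neighbour_closed_all (s : seq T) (x0 : T) : x0 \in s ->
  (forall x y, x \in s -> e x y -> y \in s) -> forall x, x \in s.
Proof.
move=> x0s s_closed x.
have cl : closed e (mem s).
  apply: (intro_closed (sym_connect_sym esym)) => y z yz ys.
  exact: s_closed ys yz.
by rewrite -(closed_connect cl (econn x0 x)).
Qed.

Lemma exists_longest (x0 : T) : exists2 p, longest p & p != [::].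
Proof.
pose P n := [exists t : n.-tuple T, sorted e t && uniq t].
have P1 : P 1 by apply/existsP; exists [tuple x0].
have P_le n : P n -> (n <= #|T|).
  case/existsP=> t /andP[_ /card_uniqP tn].
  by rewrite -(size_tuple t) -tn max_card.
case: (ex_maxnP (ex_intro P 1 P1) P_le) => n /existsP[t /andP[ts tu]] n_max.
exists t; last by have := n_max _ P1; rewrite -size_eq0 size_tuple; case: (n).
split=> // q qs qu; rewrite size_tuple; apply: n_max.
by apply/existsP; exists (in_tuple q); rewrite qs qu.
Qed.

Lemma longest_rev (p : seq T) : longest p -> longest (rev p).
Proof.
case=> ps pu pmax; split; rewrite ?rev_uniq ?size_rev // rev_sorted.
by apply: sub_sorted ps => x y; rewrite esym.
Qed.

(** Otherwise [w] could be put in front of [p]. *)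
Lemma head_neighbour (p : seq T) (x0 w : T) :
  longest p -> (0 < size p) -> e (nth x0 p 0) w -> w \in p.
Proof.
case=> ps pu pmax p0 vw; apply: contraT => wp.
have /= := pmax (w :: p) _ _; rewrite wp ltnn => -> //.
by move: ps vw; case: (p) p0 => //= a q _ -> aw; rewrite esym aw.
Qed.

Lemma last_neighbour (p : seq T) (x0 w : T) :
  longest p -> (0 < size p) -> e (nth x0 p (size p).-1) w -> w \in p.
Proof.
move=> pl p0 vw; rewrite -mem_rev.
apply: (head_neighbour (x0 := x0) (longest_rev pl)); rewrite ?size_rev //.
by rewrite nth_rev // subn1.
Qed.

(** * Chords and branches of a longest path with [k] edges *)

Section PathNeighbours.
Variables (p : seq T) (k : nat) (x0 : T).
Hypotheses (p_longest : longest p) (p_size : size p = k.+1).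
Let v i := nth x0 p i.

Lemma path_adj a b : (a < k) -> b = a.+1 -> e (v a) (v b) /\ e (v b) (v a).
Proof.
move=> ak ->; rewrite (esym (v a.+1)); suff : e (v a) (v a.+1) by [].
by have [/(sortedP x0) ps _ _] := p_longest; apply: ps; rewrite p_size.
Qed.

Lemma path_neq a b : (a <= k) -> (b <= k) -> a <> b -> v a != v b.
Proof.
have [_ pu _] := p_longest => ak bk /eqP ab.
by rewrite nth_uniq // p_size ltnS.
Qed.

Lemma path_inj a b : (a <= k) -> (b <= k) -> v a = v b -> a = b.
Proof.
move=> ak bk /eqP vab; apply/eqP; apply: contraTT vab => /eqP.
exact: path_neq.
Qed.

(** If [j < k] and the edge is not on the path, then [v j.-1], [v i], [v j.+1] are neighbours of
    [v j], and the first two have further neighbours [v j.-2] and [v i.+1], against [claw_leaf]. The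
    case [0 < i] is symmetric. *)
Lemma chord i j : (i < j) -> (j <= k) -> e (v i) (v j) ->
  j = i.+1 \/ i = 0 /\ j = k.
Proof.
move=> ij jk vij; have vji : e (v j) (v i) by rewrite esym.
have [->|ji] := eqVneq j i.+1; first by left.
have [i1 i2] : e (v i) (v i.+1) /\ e (v i.+1) (v i) by apply: path_adj; arith.
have [j1 j2] : e (v j.-1) (v j) /\ e (v j) (v j.-1) by apply: path_adj; arith.
have [jk'|/eqP jk'] := ltnP j k.
  have [j3 j4] : e (v j) (v j.+1) /\ e (v j.+1) (v j) by apply: path_adj; arith.
  have [_ j5] : e (v j.-2) (v j.-1) /\ e (v j.-1) (v j.-2) by apply: path_adj; arith.
  have [] := claw_leaf j2 vji j3 _ _ _ j5 i1; try by apply: path_neq; arith.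
    by move/path_inj; arith.
  by move/path_inj; arith.
have [->|i0] := eqVneq i 0; first by right; split; arith.
have [i3 i4] : e (v i.-1) (v i) /\ e (v i) (v i.-1) by apply: path_adj; arith.
have [i5 _] : e (v i.+1) (v i.+2) /\ e (v i.+2) (v i.+1) by apply: path_adj; arith.
have [] := claw_leaf i1 vij i4 _ _ _ i5 j2; try by apply: path_neq; arith.
  by move/path_inj; arith.
by move/path_inj; arith.
Qed.

(** The ends of a longest path have no neighbour outside it. At [v i] the neighbours [v i.-1],
    [v i.+1] and [w] form a claw, so one of the first two is a leaf: it is an end of the path, and
    no edge joins the ends. *)
Lemma branch w i : (i <= k) -> w \notin p -> e (v i) w ->
  [/\ (0 < i < k), i = 1 \/ i = k.-1 & e (v 0) (v k) -> False].
Proof.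
move=> ik wp viw.
have w_neq j : (j <= k) -> v j != w.
  move=> jk; apply: contraNneq wp => <-; rewrite mem_nth //.
  by rewrite p_size ltnS.
have i0 : i != 0.
  apply: contraNneq wp => i0; apply: (head_neighbour (x0 := x0) p_longest).
    by rewrite p_size.
  by move: viw; rewrite i0.
have ik' : i != k.
  apply: contraNneq wp => ik1; apply: (last_neighbour (x0 := x0) p_longest).
    by rewrite p_size.
  by rewrite p_size; move: viw; rewrite ik1.
have [i1 _] : e (v i) (v i.+1) /\ e (v i.+1) (v i) by apply: path_adj; arith.
have [_ i2] : e (v i.-1) (v i) /\ e (v i) (v i.-1) by apply: path_adj; arith.
have claw z1 z2 : e (v i.-1) z1 -> e (v i.+1) z2 -> z1 = v i \/ z2 = v i.
  by apply: (claw_leaf i2 i1 viw); first [apply: path_neq | apply: w_neq]; arith.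
have prev z : (1 < i) -> e (v i.+1) z -> z = v i.
  move=> i_gt1; have [_ i3] : e (v i.-2) (v i.-1) /\ e (v i.-1) (v i.-2).
    by apply: path_adj; arith.
  by case/(claw _ _ i3) => // /path_inj; arith.
have next z : (i < k.-1) -> e (v i.-1) z -> z = v i.
  move=> i_lt; have [i3 _] : e (v i.+1) (v i.+2) /\ e (v i.+2) (v i.+1).
    by apply: path_adj; arith.
  by move=> /claw /(_ i3) [] // /path_inj; arith.
split; first by arith.
  have [->|i_neq1] := eqVneq i 1; [by left | right].
  have [|i_le] := leqP k.-1 i; first by arith.
  have [_ i3] : e (v i.-2) (v i.-1) /\ e (v i.-1) (v i.-2) by apply: path_adj; arith.
  by have /path_inj := next _ i_le i3; arith.
move=> v0k; have vk0 : e (v k) (v 0) by rewrite esym.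
(* If the ends were joined, both path neighbours of [v i] would have a second neighbour on the
   cycle. *)
have prev' : e (v i.-1) (if i == 1 then v k else v i.-2).
  case: eqP => [->//|i1']; have [] : e (v i.-2) (v i.-1) /\ e (v i.-1) (v i.-2).
    by apply: path_adj; arith.
  by [].
have next' : e (v i.+1) (if i == k.-1 then v 0 else v i.+2).
  case: eqP => [i1'|i1'].
    by rewrite (_ : i.+1 = k) //; arith.
  have [] : e (v i.+1) (v i.+2) /\ e (v i.+2) (v i.+1) by apply: path_adj; arith.
  by [].
case: (claw _ _ prev' next'); case: eqP => i1' /path_inj; arith.
Qed.

Lemma branch_leaf w i z : (i <= k) -> w \notin p -> e (v i) w -> e w z ->
  z = v i.
Proof.
move=> ik wp viw wz; have [ik' i1k _] := branch ik wp viw.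
have w_neq j : (j <= k) -> w != v j.
  by move=> jk; apply: contraNneq wp => ->; rewrite mem_nth ?p_size.
have [i1 _] : e (v i) (v i.+1) /\ e (v i.+1) (v i) by apply: path_adj; arith.
have [i0 i2] : e (v i.-1) (v i) /\ e (v i) (v i.-1) by apply: path_adj; arith.
have [i_lt|i_ge] := ltnP i k.-1.
  have [i3 _] : e (v i.+1) (v i.+2) /\ e (v i.+2) (v i.+1).
    by apply: path_adj; arith.
  case: (claw_leaf viw i1 i2 _ _ _ wz i3) => //;
    try by first [apply: path_neq | apply: w_neq]; arith.
  by move/path_inj; arith.
have [i_gt|i_le] := ltnP 1 i.
  have [_ i3] : e (v i.-2) (v i.-1) /\ e (v i.-1) (v i.-2).
    by apply: path_adj; arith.
  case: (claw_leaf viw i2 i1 _ _ _ wz i3) => //;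
    try by first [apply: path_neq | apply: w_neq]; arith.
  by move/path_inj; arith.
(* What is left is [k = 2] and [i = 1], where [claw_leaf] does not help; but then [v 0], [v 1], [w],
   [z] would be a longer path. *)
apply/eqP; apply: contraT => zi.
have [_ _ /(_ [:: v i.-1; v i; w; z])] := p_longest.
have zN0 : z != v i.-1.
  apply: contraNneq wp => z0; apply: (head_neighbour (x0 := x0) p_longest).
    by rewrite p_size.
  have zw : e (v i.-1) w by rewrite -z0 esym.
  by rewrite (_ : i.-1 = 0) in zw; last by arith.
have wN := w_neq _ ik; have w0 : w != v i.-1 by apply: w_neq; arith.
have vv : v i != v i.-1 by apply: path_neq; arith.
have wzN : w != z by apply: contraTneq wz => ->; rewrite eirr.
rewrite p_size /= i0 viw wz => /(_ isT) le; suff : (4 <= k.+1) by arith.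
by apply: le; distinct.
Qed.

(** The guard [2 <= k] is there because for [k = 1] the ends are joined by the path itself. *)
Lemma path_arc i j : ((2 <= k) -> ~~ e (v 0) (v k)) ->
  (i <= k) -> (j <= k) -> e (v i) (v j) = (j == i.+1) || (i == j.+1).
Proof.
move=> open; wlog ij : i j / (i <= j) => [IH|] ik jk.
  have [/IH ->//|/ltnW/IH] := leqP i j.
  by rewrite esym orbC; apply.
have [<-|ijN] := eqVneq i j; first by rewrite eirr; arith.
have [ji|ji] := eqVneq j i.+1.
  by have [||->] := @path_adj i j; arith.
have -> : (i == j.+1) = false by arith.
apply: contraTF isT => vij.
have [||ji'|[i0 jk']] := chord _ _ vij; [arith.. |].
have := open; rewrite -jk' -i0 vij => /(_ _); arith.
Qed.

(** Joined ends leave no room for a [branch], so by connectedness the path contains every vertex. *)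
Lemma cycle_graph : (2 <= k) -> e (v 0) (v k) -> graph_iso e (tA_graph k).
Proof.
move=> k2 v0k; have [_ pu _] := p_longest.
have modE a : (a <= k) -> a.+1 %% k.+1 = if a == k then 0 else a.+1.
  by case: eqP => [->|ak] le; [rewrite modnn | rewrite modn_small; arith].
have arcE a b : (a <= b) -> (b <= k) ->
    e (v a) (v b) = (b == a.+1 %% k.+1) || (a == b.+1 %% k.+1).
  move=> ab bk; rewrite !modE //; last by arith.
  have [<-|abN] := eqVneq a b; first by rewrite eirr; case: ifP; arith.
  have [ba|ba] := eqVneq b a.+1.
    by have [||->] := @path_adj a b; [arith.. | case: ifP; case: ifP; arith].
  have [[-> ->]|ab0] : (a = 0 /\ b = k) \/ ~ (a = 0 /\ b = k) by arith.
    by rewrite v0k eqxx /= orbT.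
  have -> : e (v a) (v b) = false.
    by apply: contraTF isT => /chord []; arith.
  by case: ifP; case: ifP; arith.
apply: (graph_iso_seq (x0 := x0) p_size pu) => [|i j]; last first.
  rewrite !ltnS => ik jk; have [ij|/ltnW ij] := leqP i j; first exact: arcE.
  by rewrite esym orbC; apply: arcE.
have v0 : v 0 \in p by rewrite mem_nth ?p_size.
apply: (neighbour_closed_all v0) => x y /(nthP x0)[i + <-] xy.
rewrite p_size ltnS => ik; apply: contraT => yp.
by have [_ _ /(_ v0k)] := branch ik yp xy.
Qed.

Lemma path_graph : ((2 <= k) -> ~~ e (v 0) (v k)) ->
  (forall w i, (i <= k) -> w \notin p -> ~~ e (v i) w) ->
  graph_iso e (A_graph k.+1).
Proof.
move=> open nobranch; have [_ pu _] := p_longest.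
apply: (graph_iso_seq (x0 := x0) p_size pu) => [|i j]; last exact: path_arc.
have v0 : v 0 \in p by rewrite mem_nth ?p_size.
apply: (neighbour_closed_all v0) => x y /(nthP x0)[i + <-] xy.
rewrite p_size ltnS => ik; apply: contraTT xy; exact: nobranch.
Qed.

(** * Leaves outside the path, and the forked graphs *)

Lemma outside_neq w i : i <= k -> w \notin p -> v i != w.
Proof. by move=> ik wp; apply: contraNneq wp => <-; rewrite mem_nth ?p_size. Qed.

(** Here [v i] has four neighbours, which are all leaves by [star_leaf]; so [v i.-1] and [v i.+1]
    are the two ends of the path. *)
Lemma double_branch w y i : i <= k -> w \notin p -> y \notin p -> w != y ->
  e (v i) w -> e (v i) y -> k = 2.
Proof.
move=> ik wp yp wy viw viy; have [ik' i1k _] := branch ik wp viw.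
have [i1 _] : e (v i) (v i.+1) /\ e (v i.+1) (v i) by apply: path_adj; arith.
have [_ i0] : e (v i.-1) (v i) /\ e (v i) (v i.-1) by apply: path_adj; arith.
have n1w : v i.+1 != w by apply: outside_neq => //; arith.
have n1y : v i.+1 != y by apply: outside_neq => //; arith.
have n0w : v i.-1 != w by apply: outside_neq => //; arith.
have n0y : v i.-1 != y by apply: outside_neq => //; arith.
have n01 : v i.+1 != v i.-1 by apply: path_neq; arith.
have [i_lt|i_ge] := ltnP i k.-1.
  have [i2 _] : e (v i.+1) (v i.+2) /\ e (v i.+2) (v i.+1).
    by apply: path_adj; arith.
  have /path_inj : v i.+2 = v i by apply: star_leaf i1 i0 viw viy _ i2; distinct.
  by arith.
have [i_gt|i_le] := ltnP 1 i; last by arith.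
have [_ i2] : e (v i.-2) (v i.-1) /\ e (v i.-1) (v i.-2).
  by apply: path_adj; arith.
have /path_inj : v i.-2 = v i by apply: star_leaf i0 i1 viw viy _ i2; distinct.
by arith.
Qed.

Lemma triple_branch w y z i : i <= k -> w \notin p -> y \notin p ->
  z \notin p -> uniq [:: w; y; z] ->
  e (v i) w -> e (v i) y -> e (v i) z -> False.
Proof.
move=> ik wp yp zp u viw viy viz; have [ik' i1k _] := branch ik wp viw.
have [i1 _] : e (v i) (v i.+1) /\ e (v i.+1) (v i) by apply: path_adj; arith.
have [_ i0] : e (v i.-1) (v i) /\ e (v i) (v i.-1) by apply: path_adj; arith.
have n01 : v i.+1 != v i.-1 by apply: path_neq; arith.
have out j x : x \notin p -> j <= k -> (v j == x) = false.
  by move=> xp jk; apply: negbTE; apply: outside_neq.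
apply: (degree_le4 i1 i0 viw viy viz).
by move: u; rewrite /= !inE (negbTE n01) !out //; arith.
Qed.

Lemma branch_adj w i j : i <= k -> j <= k -> w \notin p -> e (v i) w ->
  e (v j) w = (j == i).
Proof.
move=> ik jk wp viw; have [->//|ji] := eqVneq j i; apply: contraTF isT => vjw.
have wj : e w (v j) by rewrite esym.
by have /path_inj := branch_leaf ik wp viw wj; arith.
Qed.

(** The vertices are listed as the path followed by [w], which gets the index [k.+1] of the extra
    leaf. The condition [u != w] matters for [k = 2], where [v k.-1] is [v 1]. *)
Lemma one_fork_graph w : 2 <= k -> ~~ e (v 0) (v k) ->
  w \notin p -> e (v 1) w ->
  (forall u, u \notin p -> u != w -> ~~ e (v k.-1) u) ->
  graph_iso e (D_graph k.+2).
Proof.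
move=> k2 open wp v1w nobranch; have [_ pu _] := p_longest.
have k1 := ltnW k2.
have ps : size (rcons p w) = k.+2 by rewrite size_rcons p_size.
have vw i : i <= k -> e (v i) w = (i == 1).
  by move=> ik; apply: branch_adj.
have nthE i : i < k.+2 -> nth x0 (rcons p w) i = if i == k.+1 then w else v i.
  move=> ik; rewrite nth_rcons p_size; case: eqP => [->|i1]; first by rewrite ltnn.
  by rewrite (_ : (i < k.+1) = true) //; arith.
apply: (graph_iso_seq (x0 := x0) ps); first by rewrite rcons_uniq wp.
  have ws : w \in rcons p w by rewrite mem_rcons inE eqxx.
  apply: (neighbour_closed_all ws) => x y; rewrite !(mem_rcons, inE).
  case/orP=> [/eqP -> wy|/(nthP x0)[i]].
    by rewrite (branch_leaf k1 wp v1w wy) mem_nth ?orbT // p_size.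
  rewrite p_size ltnS => ik <- viy; apply/orP.
  have [->|yw] := eqVneq y w; [by left | right; apply: contraT => yp].
  have viyN : ~~ e (v k.-1) y by apply: nobranch.
  have [_ [i1|ik1] _] := branch ik yp viy; last by rewrite -ik1 viy in viyN.
  have v1y : e (v 1) y by rewrite -i1.
  have wy : w != y by rewrite eq_sym.
  (* A second branch at [v 1] forces [k = 2], and then [v 1] is [v k.-1], where [nobranch]
     applies. *)
  by move: viyN; rewrite (double_branch k1 wp yp wy v1w v1y) v1y.
move=> i j ik jk; rewrite !nthE // subn2 subn1 /=.
case: eqP => [->|ik1]; case: eqP => [->|jk1].
- by rewrite eirr; arith.
- by rewrite esym vw; arith.
- by rewrite vw; arith.
by rewrite path_arc; arith.
Qed.

(** In the list, [w1] and [w2] follow the path, at the indices [k.+1] and [k.+2] of the two extra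
    leaves. For [k = 2] both hang at the centre of a star. *)
Lemma two_fork_graph w1 w2 : 2 <= k -> ~~ e (v 0) (v k) ->
  w1 \notin p -> w2 \notin p -> w1 != w2 -> e (v 1) w1 -> e (v k.-1) w2 ->
  graph_iso e (tD_graph k.+2).
Proof.
move=> k2 open wp1 wp2 w12 v1w vkw; have [_ pu _] := p_longest.
have k1 := ltnW k2.
have ps : size (rcons (rcons p w1) w2) = k.+3 by rewrite !size_rcons p_size.
have vw1 i : i <= k -> e (v i) w1 = (i == 1).
  by move=> ik; apply: branch_adj.
have vw2 i : i <= k -> e (v i) w2 = (i == k.-1).
  by move=> ik; apply: branch_adj => //; arith.
have ww : e w1 w2 = false.
  apply: contraTF isT => ww; move: wp2.
  by rewrite (branch_leaf k1 wp1 v1w ww) mem_nth // p_size.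
have nthE i : i < k.+3 -> nth x0 (rcons (rcons p w1) w2) i =
    if i == k.+2 then w2 else if i == k.+1 then w1 else v i.
  move=> ik; rewrite !nth_rcons size_rcons p_size.
  case: (eqVneq i k.+2) => [->|i2]; first by rewrite ltnn.
  case: (eqVneq i k.+1) => [->|i1]; first by rewrite ltnn ltnS leqnn.
  have ik1 : i < k.+1 by arith.
  by rewrite ik1 ltnW.
apply: (graph_iso_seq (x0 := x0) ps).
- by rewrite !rcons_uniq mem_rcons inE negb_or eq_sym w12 wp1 wp2.
- have ws : w1 \in rcons (rcons p w1) w2 by rewrite !(mem_rcons, inE) eqxx orbT.
  apply: (neighbour_closed_all ws) => x y; rewrite !(mem_rcons, inE).
  case/or3P=> [/eqP -> wy|/eqP -> wy|/(nthP x0)[i]].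
  + rewrite (branch_leaf _ wp2 vkw wy) ?mem_nth ?orbT // ?p_size; arith.
  + by rewrite (branch_leaf k1 wp1 v1w wy) mem_nth ?orbT // p_size.
  rewrite p_size ltnS => ik <- viy.
  have [//|yw2] := eqVneq y w2; have [//|yw1] := eqVneq y w1.
  apply: contraT => yp; rewrite eq_sym in yw1; rewrite eq_sym in yw2.
  (* A third outside vertex [y] shares its attaching vertex with [w1] or [w2]. This forces [k = 2],
     so all three hang at [v 1], which then has five neighbours. *)
  have k_eq2 : k = 2.
    have [ik' [i1|ik1] _] := branch ik yp viy; move: viy.
      by rewrite i1 => v1y; apply: (double_branch k1 wp1 yp yw1).
    rewrite ik1 => vky; apply: (double_branch _ wp2 yp yw2 vkw vky).
    by arith.
  have i1 : i = 1 by have [] := branch ik yp viy; arith.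
  case: (triple_branch (w := w1) (y := w2) (z := y) (i := 1)) => //.
  + by distinct.
  + by rewrite (_ : 1 = k.-1) // k_eq2.
  + by rewrite -i1.
move=> i j ik jk; rewrite !nthE // subn2 subn1 subSS subSS /=.
rewrite subn1.
case: (eqVneq i k.+2) => [->|ik2]; case: (eqVneq j k.+2) => [->|jk2].
- by rewrite eirr; arith.
- case: eqP => [->|jk1]; first by rewrite esym ww; arith.
  by rewrite esym vw2; arith.
- case: eqP => [->|jk1]; first by rewrite ww; arith.
  by rewrite vw2; arith.
case: (eqVneq i k.+1) => [->|ik1]; case: (eqVneq j k.+1) => [->|jk1].
- by rewrite eirr; arith.
- by rewrite esym vw1; arith.
- by rewrite vw1; arith.
by rewrite path_arc; arith.
Qed.

End PathNeighbours.

Lemma extended_Dynkin_AD (x0 : T) : exists m : nat, 0 < m /\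
    [\/ graph_iso e (A_graph m), 4 <= m /\ graph_iso e (D_graph m),
        2 <= m /\ graph_iso e (tA_graph m)
      | 4 <= m /\ graph_iso e (tD_graph m)].
Proof.
have [p p_longest p0] := exists_longest x0.
have [k pk] : exists k, size p = k.+1.
  by exists (size p).-1; rewrite prednK // lt0n size_eq0.
have [k1|k2] := leqP k 1.
  exists k.+1; split=> //; apply: Or41.
  apply: (path_graph (x0 := x0) p_longest pk) => [|w i ik wp]; first by arith.
  by apply/negP => /(branch p_longest pk ik wp) []; arith.
have [cyc|open] := boolP (e (nth x0 p 0) (nth x0 p k)).
  exists k; split; first by arith.
  by apply: Or43; split=> //; apply: cycle_graph p_longest pk k2 cyc.
(* One branch at index 1 is given; the type depends on whether another outside vertex hangs at the
   index [k.-1]. *)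
have fork q w : longest q -> size q = k.+1 -> ~~ e (nth x0 q 0) (nth x0 q k) ->
    w \notin q -> e (nth x0 q 1) w ->
    graph_iso e (D_graph k.+2) \/ graph_iso e (tD_graph k.+2).
  move=> ql qk qopen wq vw.
  case: (pickP [pred u | [&& u \notin q, u != w & e (nth x0 q k.-1) u]]) =>
      [u /and3P[uq uw vu]|none].
    by right; apply: (two_fork_graph ql qk k2 qopen wq uq _ vw vu); rewrite eq_sym.
  left; apply: (one_fork_graph ql qk k2 qopen wq vw) => u uq uw.
  by have /= := none u; rewrite uq uw /= => ->.
have [w /andP[wp v1w]|none1] := pickP [pred u | (u \notin p) && e (nth x0 p 1) u].
  exists k.+2; split=> //.
  by have [] := fork p w; [..|move=> ?; apply: Or42|move=> ?; apply: Or44].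
have [w /andP[wp vkw]|nonek] := pickP [pred u | (u \notin p) && e (nth x0 p k.-1) u].
  exists k.+2; split=> //.
  (* Reversing the path moves the branch from index [k.-1] to index 1. *)
  have [||||||] := fork (rev p) w; rewrite ?size_rev ?mem_rev //.
  - exact: longest_rev.
  - by rewrite !nth_rev ?pk // subnn subn1 /= esym.
  - by rewrite nth_rev ?pk ?subn2 //; arith.
  - by move=> ?; apply: Or42.
  - by move=> ?; apply: Or44.
exists k.+1; split=> //; apply: Or41.
apply: (path_graph (x0 := x0) p_longest pk) => // w i ik wp; apply/negP => viw.
have [_ [i1|i1] _] := branch p_longest pk ik wp viw.
  by have := none1 w; rewrite /= wp -i1 viw.
by have := nonek w; rewrite /= wp -i1 viw.
Qed.

End LongestPath.

(** * Reduced representations *)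

Lemma common_fat_nbrsxx (H : hoffman) (x : vert H) :
  common_fat_nbrs x x = fat_nbrs x.
Proof. exact: finset.setIid. Qed.

Lemma hoffman_mxE (R : realType) (H : hoffman) i j :
  hoffman_mx R H i j = (adj (val (enum_val i)) (val (enum_val j)))%:R
    - #|common_fat_nbrs (val (enum_val i)) (val (enum_val j))|%:R.
Proof.
rewrite !mxE; congr (_ - _).
set x := val _; set y := val _.
transitivity (\sum_(z : fat_vert H) (adj x (val z) && adj y (val z))%:R : R).
  apply: etrans (esym (big_enum_val (A := xpredT) _)).
  by apply: eq_bigr => k _; rewrite !mxE -natrM mulnb.
rewrite -(big_sub (fat (h := H)) (fun z => (adj x z && adj y z)%:R : R)).
rewrite -natr_sum -big_mkcondr /= sum1_card; congr (_%:R).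
apply: eq_card => z; rewrite !inE.
transitivity (fat z && (adj x z && adj y z)) ; first by [].
by case: (fat z).
Qed.

Lemma dotv_ge0 (R : realType) (N : nat) (u : 'rV[R]_N) : 0 <= dotv u u.
Proof. by apply: sumr_ge0 => i _; rewrite -expr2 sqr_ge0. Qed.

Lemma dotv_gt0 (R : realType) (N : nat) (u : 'rV[R]_N) : u != 0 -> 0 < dotv u u.
Proof.
move=> u0; rewrite lt_def dotv_ge0 andbT; apply: contraNneq u0 => /eqP.
rewrite psumr_eq0 => [/allP uu|i _]; last by rewrite -expr2 sqr_ge0.
apply/eqP/rowP => i; rewrite mxE; apply/eqP.
by have := uu i (mem_index_enum _); rewrite mulf_eq0 orbb.
Qed.

Lemma dotvE (R : realType) (N : nat) (u w : 'rV[R]_N) :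
  dotv u w = (u *m w^T) 0 0.
Proof. by rewrite mxE; apply: eq_bigr => i _; rewrite !mxE. Qed.

(** With the vectors of [psi] as rows of [P], the matrix is [P *m P^T - m%:M]. So if [v] is an
    eigenvector for [a], then [a + m] times the norm of [v] is the norm of [v *m P], which is
    non-negative. *)
Lemma lambda_min_ge (R : realType) (H : hoffman) (m : R) (N : nat)
    (psi : slim_vert H -> 'rV[R]_N) :
  0 <= m -> reduced_rep m psi -> - m <= lambda_min R H.
Proof.
move=> m0 psiP; rewrite /lambda_min; set E := [set _ | _]%classic.
(* The infimum of the empty set is 0 by default, and [0 <= m] settles that case. *)
have [->|/set0P E0] := eqVneq E set0; first by rewrite inf0 oppr_le0.
apply: lb_le_inf => // a /eigenvalueP[v va v0].
pose P : 'M[R]_(#|slim_vert H|, N) := \matrix_i psi (enum_val i).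
have BE : hoffman_mx R H = P *m P^T - m%:M.
  apply/matrixP => i j; rewrite hoffman_mxE !mxE.
  have := psiP (enum_val i) (enum_val j).
  rewrite (eq_bigr (fun k => P i k * P j k)) => [|k _]; last by rewrite !mxE.
  under eq_bigr do rewrite !mxE.
  rewrite -/(dotv _ _) => ->.
  rewrite (inj_eq enum_val_inj); case: eqVneq => [->|ij].
    by rewrite adj_irr common_fat_nbrsxx /=; ring.
  by case: (adj _ _); rewrite mulr0n subr0 // sub0r.
have : (a + m) * dotv v v = dotv (v *m P) (v *m P).
  rewrite [RHS]dotvE trmx_mul mulmxA -(mulmxA v) -[P *m P^T](subrK m%:M) -BE.
  rewrite mulmxDr va mul_mx_scalar -scalerDl -scalemxAl mxE; congr (_ * _).
  by rewrite dotvE.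
move=> eqP; rewrite -[- m]add0r lerBlDr -(pmulr_lge0 _ (dotv_gt0 v0)) eqP.
exact: dotv_ge0.
Qed.

(** * Attaching a fat vertex *)

Section Attach.
Variables (H : hoffman) (S : {set slim_vert H}) (S0 : S != finset.set0).

Lemma attach_slimP (z : slim_vert (attach S0)) :
  exists x : slim_vert H, val z = Some (val x).
Proof. by case: z => -[x|] zs //=; exists (exist _ x zs). Qed.

Lemma card_attach_common_fat (x y : slim_vert H) :
  #|@common_fat_nbrs (attach S0) (Some (val x)) (Some (val y))| =
    (#|common_fat_nbrs (val x) (val y)| + ((x \in S) && (y \in S)))%N.
Proof.
rewrite (cardsD1 None) !inE /= !(mem_imset _ _ val_inj) addnC; congr (_ + _)%N.
rewrite -(card_imset _ (@Some_inj _)); apply: eq_card => -[z|].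
  by rewrite (mem_imset _ _ (@Some_inj _)) !inE.
by rewrite !inE; symmetry; apply/imsetP => -[].
Qed.

Variables (R : realType) (m : R) (n : nat) (chi : slim_vert H -> 'rV[R]_n).
Variables (t : R) (i : 'I_n).

(* Projecting [chi] orthogonally to the coordinate [i], which is [t] times the
   indicator function of [S], lowers each inner product by exactly what the new
   fat vertex contributes. *)
Lemma attach_reduced_rep : t * t = 1 ->
  (forall x, chi x 0 i = t * (x \in S)%:R) -> reduced_rep m chi ->
  exists psi : slim_vert (attach S0) -> 'rV[R]_n, reduced_rep m psi.
Proof.
move=> tt chiS chiP; have [old oldP] := boolp.choice attach_slimP.
exists (fun z => \row_j if j == i then 0 else chi (old z) 0 j) => x y.
have -> : (x == y) = (old x == old y).
  apply/eqP/eqP => [->//|xy].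
  by apply: val_inj; rewrite !oldP xy.
have <- : dotv (chi (old x)) (chi (old y)) - (old x \in S)%:R * (old y \in S)%:R =
    dotv (\row_j (if j == i then 0 else chi (old x) 0 j))
      (\row_j (if j == i then 0 else chi (old y) 0 j)).
  rewrite /dotv (bigD1 i) //= [RHS](bigD1 i) //= !mxE !eqxx mul0r add0r !chiS.
  rewrite mulrACA tt mul1r addrC addrK; apply: eq_bigr => j /negPf ji.
  by rewrite !mxE ji.
rewrite chiP -(common_fat_nbrsxx (val x)) -(common_fat_nbrsxx (val (old x))).
rewrite !oldP !card_attach_common_fat /= andbb -natrM mulnb !natrD.
case: eqVneq => [->|_]; first by rewrite andbb; ring.
by case: (adj _ _); ring.
Qed.

End Attach.

(** * Special graphs *)

Definition slim_closure (H : hoffman) (A : {set slim_vert H}) : {set vert H} :=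
  [set v | [exists x in A, (v == val x) || (v \in fat_nbrs (val x))]].

Lemma slim_closureP (H : hoffman) (A : {set slim_vert H}) (v : vert H) :
  reflect (exists2 x, x \in A & v = val x \/ fat v /\ adj (val x) v)
    (v \in slim_closure A).
Proof.
rewrite inE; apply: (iffP exists_inP) => -[x xA vx]; exists x => //.
  case/orP: vx => [/eqP|]; first by left.
  by rewrite inE => /andP[]; right.
apply/orP; case: vx => [/eqP|[fv xv]]; [by left | right].
by rewrite inE fv.
Qed.

Lemma slim_part_closure (H : hoffman) (A : {set slim_vert H}) :
  slim_part (slim_closure A) = val @: A.
Proof.
apply/setP => v; rewrite inE; apply/andP/imsetP => [[]|[x xA ->]].
  by case/slim_closureP => x xA [-> _|[fv _]]; [exists x | rewrite /slim fv].
by split; [apply/slim_closureP; exists x; [|left] | exact: valP x].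
Qed.

(** The closures of [A] and of its complement would form a sum: taking all fat neighbours keeps fat
    adjacencies inside each part, and the hypothesis on [A] is the condition on pairs across. Every
    fat vertex is covered because it has a slim neighbour. *)
Lemma indecomposable_split (H : hoffman) (A : {set slim_vert H}) :
  indecomposable H -> A != finset.set0 -> ~: A != finset.set0 ->
  (forall x y, x \in A -> y \notin A ->
     #|common_fat_nbrs (val x) (val y)| = adj (val x) (val y)) -> False.
Proof.
move=> indH A0 AC0 cE; apply: indH; exists (slim_closure A), (slim_closure (~: A)).
have sub (B : {set slim_vert H}) : B != finset.set0 -> hoffman_subset (slim_closure B).
  move=> /set0Pn[b bB]; split.
    by apply/set0Pn; exists (val b); apply/slim_closureP; exists b; [|left].
  move=> v /slim_closureP[x xB [->|[_ xv]]] fv.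
    by have := valP x; rewrite /slim fv.
  exists (val x); rewrite adj_sym xv (valP x) !andbT.
  by apply/slim_closureP; exists x; [|left].
have fat_nbr (B : {set slim_vert H}) x y : x \in slim_part (slim_closure B) ->
    fat y -> adj x y -> y \in slim_closure B.
  rewrite slim_part_closure => /imsetP[x' x'B ->] fy xy.
  by apply/slim_closureP; exists x'; [|right].
have cover x : (x \in A) || (x \in ~: A) by rewrite inE; case: (x \in A).
split; [exact: sub | exact: sub | split].
- apply/setP => v; rewrite !finset.in_setT finset.in_setU.
  have [fv|sv] := boolP (fat v).
    have [y /andP[sy vy]] := fat_has_slim fv.
    pose y' : slim_vert H := exist _ y sy.
    by have /orP[y'A|y'A] := cover y'; apply/orP; [left | right];
      apply/slim_closureP; exists y' => //; right; rewrite adj_sym.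
  pose v' : slim_vert H := exist _ v sv.
  by have /orP[v'A|v'A] := cover v'; apply/orP; [left | right];
    apply/slim_closureP; exists v' => //; left.
- rewrite !slim_part_closure; split.
  + by rewrite imset_eq0.
  + by rewrite imset_eq0.
  + by rewrite -(imsetI (in2W val_inj)) finset.setICr imset0.
  + rewrite -imsetU finset.setUCr; apply/setP => v; rewrite inE.
    apply/imsetP/idP => [[x _ ->]|sv]; first exact: valP x.
    by exists (exist _ v sv).
- by split; apply: fat_nbr.
move=> x y; rewrite !slim_part_closure => /imsetP[x' xA ->] /imsetP[y' + ->].
rewrite inE => /(cE _ _ xA) ->; split; first by case: adj.
by case: adj.
Qed.

(** * Connectedness and type of the special graph *)

Section IntegralRepresentation.
Variables (H : hoffman) (n : nat) (a : slim_vert H -> 'I_n -> int).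

Local Notation common x y := #|common_fat_nbrs (val x) (val y)|.

Hypothesis fatH : is_fat_hoffman H.
Hypothesis aP : forall x y, dotz (a x) (a y) =
  (if x == y then 3 else (adj (val x) (val y))%:Z) - (common x y)%:Z.

Let e : rel (slim_vert H) := fun x y => (x != y) && (dotz (a x) (a y) < 0).

Lemma integral_short x : dotz (a x) (a x) <= 2.
Proof.
rewrite aP eqxx; have [z /andP[fz xz]] := fatH (valP x).
suff : (0 < common x x)%N by lia.
by rewrite card_gt0; apply/set0Pn; exists z; rewrite !inE fz xz.
Qed.

(** Common fat neighbours are among those of [x]. In particular a vector of norm 2 has inner product
    at least -1 with every other one. *)
Lemma integral_dot_ge x y : x != y -> dotz (a x) (a x) - 3 <= dotz (a x) (a y).
Proof.
move=> xy; rewrite !aP eqxx (negPf xy).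
have : (common x y <= common x x)%N.
  by rewrite common_fat_nbrsxx subset_leq_card // subsetIl.
by case: (adj _ _) => /=; lia.
Qed.

Let esym : symmetric e.
Proof. by move=> x y; rewrite /e eq_sym dotzC. Qed.

Lemma dot_lt0_special x y : dotz (a x) (a y) < 0 -> e x y.
Proof.
move=> xy; rewrite /e xy andbT; apply: contraTneq xy => ->.
by rewrite -leNgt dotz_ge0.
Qed.

Hypothesis signs : forall x i, a x i != 0 -> exists z, a z i = - a x i.

(** If [x] and [z] are not adjacent, then [a x] and the negative of [a z] are twins, so [a x] and
    [a z] agree at a second coordinate [j]. A vertex [w] of opposite sign at [j] is adjacent to
    both. *)
Lemma opposite_connected x z i : a x i * a z i < 0 -> connect e x z.
Proof.
move=> xzi; have [xz|xz] := ltP (dotz (a x) (a z)) 0.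
  exact/connect1/dot_lt0_special.
have opp2 : dotz (fun k => - a z k) (fun k => - a z k) <= 2.
  rewrite /dotz; under eq_bigr do rewrite mulrNN.
  exact: integral_short.
have xoz : dotz (a x) (fun k => - a z k) <= 0.
  by rewrite /dotz; under eq_bigr do rewrite mulrN; rewrite sumrN oppr_le0.
have xozi : 0 < a x i * - a z i by rewrite mulrN oppr_gt0.
have [j [ji xj xi xzj dotx]] := short_twins (integral_short x) opp2 xoz xozi.
rewrite opprK in xzj; have [w wj] := signs xj.
have xi0 : a x i != 0 by apply: contraTneq xzi => ->; rewrite mul0r.
have zi : a z i = - a x i by rewrite xi opprK.
have dot_z : forall c, dotz (a z) c = - a x i * c i + a x j * c j.
  move=> c.
  rewrite -zi xzj; apply: short_support; first exact: integral_short.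
  - by rewrite eq_sym.
  - by rewrite zi oppr_eq0.
  - by rewrite -xzj.
have xi1 := short_unit (integral_short x) xi0.
have xj1 := short_unit (integral_short x) xj.
have wi1 := short_entry i (integral_short w).
have xw : dotz (a x) (a w) = a x i * a w i - 1.
  by rewrite dotx wj; case: xj1 => ->; ring.
have zw : dotz (a z) (a w) = - (a x i * a w i) - 1.
  by rewrite dot_z wj; case: xj1 => ->; ring.
have xx : dotz (a x) (a x) = 2 by rewrite dotx; case: xi1 => ->; case: xj1 => ->.
have zz : dotz (a z) (a z) = 2.
  by rewrite dot_z zi -xzj; case: xi1 => ->; case: xj1 => ->.
have ge_xw : -1 <= dotz (a x) (a w).
  have [<-|/integral_dot_ge] := eqVneq x w; first by rewrite xx.
  by rewrite xx.
have ge_zw : -1 <= dotz (a z) (a w).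
  have [<-|/integral_dot_ge] := eqVneq z w; first by rewrite zz.
  by rewrite zz.
(* The two inner products with [a w] add up to -2 and each is at least -1, so both equal -1. *)
have exw : e x w by apply: dot_lt0_special; clear -ge_zw zw xw; lia.
have ezw : e z w by apply: dot_lt0_special; clear -ge_xw zw xw; lia.
by apply: connect_trans (connect1 exw) _; apply: connect1; rewrite esym.
Qed.

(** Between the component of [x] and the rest no inner product is negative. None is positive either:
    a vertex of opposite sign at a common coordinate would connect the two sides. So all vanish, and
    the component splits off. *)
Lemma special_connected x y : indecomposable H -> connect e x y.
Proof.
move=> indH; apply: contraT => xy.
pose A := [set z | connect e x z].
case: (indecomposable_split (A := A) indH).
- by apply/set0Pn; exists x; rewrite inE connect0.
- by apply/set0Pn; exists y; rewrite !inE.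
move=> z w; rewrite !inE => xz xw.
have zwN : z != w by apply: contraNneq xw => <-.
have zw0 : 0 <= dotz (a z) (a w).
  rewrite leNgt; apply: contra xw => /dot_lt0_special zw.
  exact: connect_trans xz (connect1 zw).
suff : dotz (a z) (a w) <= 0.
  by move: zw0; rewrite aP (negPf zwN); case: (adj _ _) => /=; lia.
rewrite leNgt; apply: contra xw => /dotz_gt0[i zwi].
have zi : a z i != 0 by apply: contraTneq zwi => ->; rewrite mul0r.
have [u ui] := signs zi.
have zu : connect e z u.
  apply: (opposite_connected (i := i)); rewrite ui mulrN oppr_lt0.
  by have := sqz_gt0 zi; clear; lia.
apply: connect_trans xz (connect_trans zu _).
by apply: (opposite_connected (i := i)); rewrite ui mulNr oppr_lt0.
Qed.

(* Tensoring [a x] with the indicator vector of the fat neighbours of [x]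
   multiplies each inner product by the number of common fat neighbours: the
   positive ones vanish and the negative ones stay negative. *)
Let root (x : slim_vert H) (p : 'I_n * vert H) : int :=
  a x p.1 * (p.2 \in fat_nbrs (val x))%:Z.

Lemma dot_root x y : dotz (root x) (root y) = dotz (a x) (a y) * (common x y)%:Z.
Proof.
rewrite /dotz /root -(pair_bigA _ (fun i f =>
  (a x i * (f \in fat_nbrs (val x))%:Z) * (a y i * (f \in fat_nbrs (val y))%:Z))) /=.
rewrite mulr_suml; apply: eq_bigr => i _.
under eq_bigr do rewrite mulrACA -PoszM mulnb.
rewrite -mulr_sumr; congr (_ * _).
rewrite -sum1_card -[RHS]natz natr_sum [RHS]big_mkcond.
by apply: eq_bigr => f _; rewrite finset.in_setI; case: (_ && _).
Qed.

(** With [c] fat neighbours the norm is [(3 - c) * c], which is at most 2 for every natural number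
    [c]. *)
Lemma root_short x : dotz (root x) (root x) <= 2.
Proof. by rewrite dot_root aP eqxx; case: #|_| => [|[|c]] //; clear; nia. Qed.

Lemma root_le0 x y : x != y -> dotz (root x) (root y) <= 0.
Proof.
move=> /negPf xy; rewrite dot_root aP xy.
by case: (adj _ _) => /=; case: #|_| => [|c]; clear; nia.
Qed.

Lemma root_special x y : e x y = (x != y) && (dotz (root x) (root y) < 0).
Proof.
rewrite /e; case: eqVneq => //= /negPf xy; rewrite dot_root aP xy.
by case: (adj _ _) => /=; case: #|_| => [|c]; clear; apply/idP/idP; nia.
Qed.

Lemma special_graph_AD : indecomposable H ->
  connected_graph e /\
  exists m : nat, (0 < m)%N /\
    [\/ graph_iso e (A_graph m), (4 <= m)%N /\ graph_iso e (D_graph m),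
        (2 <= m)%N /\ graph_iso e (tA_graph m)
      | (4 <= m)%N /\ graph_iso e (tD_graph m)].
Proof.
move=> indH; have conn x y := special_connected x y indH.
have [x0] : exists x : slim_vert H, true.
  have /card_gt0P[v _] := vert_gt0 H.
  have [/fat_has_slim[y /andP[sy _]]|sv] := boolP (fat v).
    by exists (exist _ y sy).
  by exists (exist _ v sv).
split; first by split=> //; apply/card_gt0P; exists x0.
have [c [c_le2 c_leaf]] := root_coloring root_short root_le0 root_special.
have eirr : irreflexive e by move=> x; rewrite /e eqxx.
exact: extended_Dynkin_AD esym eirr conn c_le2 c_leaf x0.
Qed.

End IntegralRepresentation.

(** * Integral coordinates and saturation *)

Section Representations.
Variables (R : realType) (H : hoffman).

Lemma lattice_gen_mem (N : nat) (psi : slim_vert H -> 'rV[R]_N) x :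
  lattice_gen psi (psi x).
Proof.
exists [ffun y => (y == x)%:Z]; rewrite (bigD1 x) //= ffunE eqxx big1 ?addr0 //.
by move=> y /negPf yx; rewrite ffunE yx.
Qed.

Lemma integral_coordinates (N n : nat) (psi : slim_vert H -> 'rV[R]_N)
    (L : set 'rV[R]_n) :
  sublattice L (standard_lattice R n) -> lattice_isometric (lattice_gen psi) L ->
  exists a : slim_vert H -> 'I_n -> int,
    forall x y, dotv (psi x) (psi y) = (dotz (a x) (a y))%:~R.
Proof.
move=> [LZ _ _] [phi [[phiL _ _] _ phi_dot]].
have /boolp.choice[a aP] (x : slim_vert H) :
    exists b : 'I_n -> int, forall i, phi (psi x) 0 i = (b i)%:~R.
  have /boolp.choice[b bP] := LZ _ (phiL _ (lattice_gen_mem psi x)).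
  by exists b.
exists a => x y; rewrite -phi_dot; [|exact: lattice_gen_mem..].
by rewrite /dotv /dotz rmorph_sum; apply: eq_bigr => i _; rewrite !aP rmorphM.
Qed.

(* If the [i]-th coordinates of the short integral vectors [a x] all had the
   same sign, a fat vertex could be attached to the slim vertices at which they
   do not vanish. *)
Lemma saturated_signs (n : nat) (a : slim_vert H -> 'I_n -> int) x i :
  saturated (3 : R) H ->
  reduced_rep 3 (fun y => \row_j (a y j)%:~R : 'rV[R]_n) ->
  (forall y, dotz (a y) (a y) <= 2) -> a x i != 0 -> exists z, a z i = - a x i.
Proof.
move=> [_ satH] aP short xi; apply/not_existsP => noneg.
pose S := [set y | a y i == a x i].
have S0 : S != finset.set0 by apply/set0Pn; exists x; rewrite inE.
apply: (satH S S0).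
have xi1 := short_unit (short x) xi.
have tt : (a x i)%:~R * (a x i)%:~R = 1 :> R by case: xi1 => ->; rewrite -intrM.
have aS y : (\row_j (a y j)%:~R : 'rV[R]_n) 0 i = (a x i)%:~R * (y \in S)%:R.
  rewrite mxE inE; case: eqP => [->|yx]; first by rewrite mulr1.
  (* The entry is -1, 0 or 1; it differs from [a x i] as [y] is not in [S], and from its negative by
     [noneg]. *)
  suff -> : a y i = 0 by rewrite mulr0.
  have := noneg y; have := short_entry i (short y); case: xi1 yx => ->; clear; lia.
have [psi psiP] := attach_reduced_rep S0 tt aS aP.
exact: lambda_min_ge psiP.
Qed.

End Representations.

Theorem theorem4p8 (R : realType) (H : hoffman) (n N : nat)
    (psi : slim_vert H -> 'rV[R]_N)
    (fatH : is_fat_hoffman H) (indH : indecomposable H)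
    (satH : saturated (3 : R) H)
    (psiP : reduced_rep 3 psi)
    (embH : exists L : set 'rV[R]_n,
      sublattice L (standard_lattice R n) /\
      lattice_isometric (lattice_gen psi) L) :
  connected_graph (special_adj psi) /\
  exists m : nat, (0 < m)%N /\
    [\/ graph_iso (special_adj psi) (A_graph m),
        (4 <= m)%N /\ graph_iso (special_adj psi) (D_graph m),
        (2 <= m)%N /\ graph_iso (special_adj psi) (tA_graph m)
      | (4 <= m)%N /\ graph_iso (special_adj psi) (tD_graph m)].
Proof.
have [L [LZ psiL]] := embH.
have [a aE] := integral_coordinates LZ psiL.
have aP x y : dotz (a x) (a y) =
    (if x == y then 3 else (adj (val x) (val y))%:Z)
      - #|common_fat_nbrs (val x) (val y)|%:Z.
  apply: (@intr_inj R); rewrite -aE psiP rmorphB /=.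
  case: eqVneq => [->|_]; first by rewrite common_fat_nbrsxx.
  by case: (adj _ _) => //=; rewrite sub0r.
have short := integral_short fatH aP.
have signs x i : a x i != 0 -> exists z, a z i = - a x i.
  (* The integral vectors, read in [R], are again a reduced representation of norm 3. *)
  apply: (saturated_signs satH) => // y z; rewrite -psiP aE /dotv /dotz rmorph_sum.
  by apply: eq_bigr => j _; rewrite !mxE rmorphM.
have -> : special_adj psi = fun x y => (x != y) && (dotz (a x) (a y) < 0).
  by apply/funext => x; apply/funext => y; rewrite /special_adj aE ltrz0.
exact: special_graph_AD fatH aP signs indH.
Qed.
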